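(* Every simple graph is isomorphic to a fiber graph; that is, for every simple graph $G$ there exist $d\in\mathbb{N}$, a lattice polytope $P\subset\mathbb{Q}^d$ and a set of moves $\mathcal{M}\subset\mathbb{Z}^d$ such that $G\cong P(\mathcal{M})$.
   Context: $\mathbb{N}=\{0,1,2,\dots\}$. Graphs are finite and simple, i.e. undirected, without loops or multiple edges. A polytope $P\subset\mathbb{Q}^d$ is a lattice polytope if all its vertices are in $\mathbb{Z}^d$. A finite set $\mathcal{M}\subset\mathbb{Z}^d\setminus\{0\}$ is a set of moves if $\mathcal{M}=-\mathcal{M}$ and if for all $\lambda\in\mathbb{N}$ with $\lambda\ge 2$ and all $m\in\mathcal{M}$, $\lambda\cdot m\notin\mathcal{M}$. For a lattice polytope $P\subset\mathbb{Q}^d$ and a set of moves $\mathcal{M}\subset\mathbb{Z}^d$, the fiber graph $P(\mathcal{M})$ is the graph with node set $P\cap\mathbb{Z}^d$ in which two nodes $u$ and $v$ are adjacent if $u-v\in\mathcal{M}$. *)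

(* Defs.v *)
From mathcomp Require Import all_boot all_order all_algebra.
From mathcomp Require Import boolp classical_sets functions cardinality.
From mathcomp Require Import convex.

Set Implicit Arguments.
Unset Strict Implicit.
Unset Printing Implicit Defensive.

Import Order.TTheory GRing.Theory Num.Theory.
Local Open Scope classical_set_scope.
Local Open Scope ring_scope.

Definition dotp (d : nat) (c x : 'rV[rat]_d) : rat := \sum_(i < d) c 0 i * x 0 i.

Definition convex_hull (d : nat) (S : set 'rV[rat]_d) : set 'rV[rat]_d :=
  smallest (@convex_set rat 'rV[rat]_d) S.

(* The empty set is a polytope: the convex hull of no points. *)
Definition polytope (d : nat) (P : set 'rV[rat]_d) : Prop :=
  exists2 S : set 'rV[rat]_d, finite_set S & P = convex_hull S.

Definition face (d : nat) (P F : set 'rV[rat]_d) : Prop :=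
  exists (c : 'rV[rat]_d) (b : rat),
    (forall x, P x -> dotp c x <= b) /\ F = P `&` [set x | dotp c x = b].

Definition vertex (d : nat) (P : set 'rV[rat]_d) (v : 'rV[rat]_d) : Prop :=
  face P [set v].

Definition int_to_rat (d : nat) (u : 'rV[int]_d) : 'rV[rat]_d := map_mx intr u.

Definition lattice_polytope (d : nat) (P : set 'rV[rat]_d) : Prop :=
  polytope P /\ vertex P `<=` range (@int_to_rat d).

Definition set_of_moves (d : nat) (M : set 'rV[int]_d) : Prop :=
  [/\ finite_set M, ~ M 0, M = [set - m | m in M] &
      forall (l : nat) (m : 'rV[int]_d), (2 <= l)%N -> M m -> ~ M (m *+ l)].

(* The set of lattice points of [P], with coordinates read in [int]. *)
Definition lattice_points (d : nat) (P : set 'rV[rat]_d) : set 'rV[int]_d :=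
  @int_to_rat d @^-1` P.

(* A graph is given by its adjacency relation on its type of nodes; here the
   nodes form the subtype associated with [lattice_points P]. *)
Definition fiber_graph (d : nat) (P : set 'rV[rat]_d) (M : set 'rV[int]_d) :
    rel (lattice_points P) :=
  fun u v => val u - val v \in M.
Arguments fiber_graph [d] P M.

Definition graph_isomorphic (V W : Type) (e : rel V) (e' : rel W) : Prop :=
  exists2 f : V -> W, bijective f & forall x y, e x y = e' (f x) (f y).

(* Main.v *)
Require Import Defs.
From mathcomp Require Import all_boot all_order all_algebra.
From mathcomp Require Import boolp classical_sets functions cardinality.
From mathcomp Require Import interval_inference convex lra.

(** Take the dimension to be the number of nodes and let [P] be the standard
    simplex, the convex hull of the unit vectors.  A point of [P] has nonnegative
    coordinates of sum [1], so its lattice points are exactly the unit vectors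
    ([hull_unit_vectors], [int_simplex_point]): they are the nodes of the graph.
    The moves are the differences [e_i - e_j] for all edges [ij].  For distinct
    nodes, such a difference determines the ordered pair [(i, j)]
    ([unit_vector_diff_inj]), so no pair of unit vectors other than the edges of
    the graph is joined by a move, and no difference is a proper multiple of
    another, because the largest coordinate of each is [1].

    That [P] is a lattice polytope amounts to its vertices being unit vectors,
    which is the general fact that the vertices of a convex hull lie in every
    generating set ([vertex_convex_hull]). *)

Set Implicit Arguments.
Unset Strict Implicit.
Unset Printing Implicit Defensive.

Import Order.TTheory GRing.Theory Num.Theory.
Local Open Scope classical_set_scope.
Local Open Scope ring_scope.

(** Convexity tested with plain rational weights, in place of the bundled
    elements of the unit interval in the definition of [convex_set]. *)
Lemma convex_set_of_weights (d : nat) (A : set 'rV[rat]_d) :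
  (forall (x y : 'rV[rat]_d) (t : rat), 0 <= t <= 1 ->
     A x -> A y -> A (t *: x + (1 - t) *: y)) ->
  @convex_set rat 'rV[rat]_d A.
Proof.
move=> cA x y t /set_mem Ax /set_mem Ay; apply/mem_set; apply: cA => //.
by rewrite ge0 le1.
Qed.

Lemma dotp_conv (d : nat) (c x y : 'rV[rat]_d) (t : rat) :
  dotp c (t *: x + (1 - t) *: y) = t * dotp c x + (1 - t) * dotp c y.
Proof.
rewrite /dotp !mulr_sumr -big_split; apply: eq_bigr => i _ /=.
by rewrite !mxE mulrDr !(mulrCA (c 0 i)).
Qed.

(** If the supporting hyperplane of a vertex [v] missed [S], then [S] would lie
    in the open half-space below it, which is convex and hence would contain the
    whole hull, [v] included. *)
Lemma vertex_convex_hull (d : nat) (S : set 'rV[rat]_d) :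
  vertex (convex_hull S) `<=` S.
Proof.
move=> v [c [b [le_b Fv]]]; apply: contrapT => nSv.
have [hv cv] : (convex_hull S `&` [set x | dotp c x = b]) v by rewrite -Fv.
suff : dotp c v < b by rewrite cv ltxx.
apply: (hv [set x | dotp c x < b]); split.
  apply: convex_set_of_weights => x y t /andP[t0 t1] /= xb yb.
  (* The inequality is strict because one of the two weights is positive. *)
  rewrite dotp_conv; have [->|t_neq0] := eqVneq t 0; first by lra.
  have : 0 < t * (b - dotp c x).
    by rewrite mulr_gt0 ?subr_gt0 // lt_neqAle eq_sym t_neq0.
  have : 0 <= (1 - t) * (b - dotp c y) by rewrite mulr_ge0 ?subr_ge0 // ltW.
  lra.
move=> s Ss /=; have hs : convex_hull S s by apply: sub_gen_smallest.
rewrite lt_neqAle le_b // andbT; apply/eqP => cs.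
by apply: nSv; suff <- : [set v] s by []; rewrite Fv.
Qed.

(** The right-hand side, the standard simplex given by its inequalities, is
    convex and contains the unit vectors. *)
Lemma hull_unit_vectors (d : nat) :
  convex_hull (range (fun i : 'I_d => delta_mx 0 i)) `<=`
  [set x | (forall i, 0 <= x 0 i) /\ \sum_i x 0 i = 1].
Proof.
apply: smallest_sub.
  apply: convex_set_of_weights => x y t /andP[t0 t1] [x0 x1] [y0 y1].
  split=> [i|].
    by rewrite !mxE addr_ge0 // mulr_ge0 ?subr_ge0.
  under eq_bigr do rewrite !mxE.
  by rewrite big_split /= -!mulr_sumr x1 y1 !mulr1 subrKC.
move=> _ [i _ <-]; split=> [j|]; first by rewrite mxE ler0n.
rewrite (bigD1 i) //= mxE !eqxx big1 ?addr0 // => j ji.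
by rewrite mxE (negbTE ji) andbF.
Qed.

(** Some coordinate is nonzero, hence at least [1], and then the sum leaves only
    [0] for the others. *)
Lemma int_simplex_point (d : nat) (u : 'rV[int]_d) :
  (forall i, 0 <= u 0 i) -> \sum_i u 0 i = 1 -> exists i, u = delta_mx 0 i.
Proof.
move=> u0 u1.
have [i ui] : exists i, u 0 i != 0.
  apply: contrapT => nz; move: u1; rewrite big1 // => i _.
  by apply/eqP; apply: contrapT => /negP ui; apply: nz; exists i.
have ui1 : 1 <= u 0 i by rewrite -gtz0_ge1 lt_neqAle eq_sym ui u0.
have rest_ge0 : 0 <= \sum_(j | j != i) u 0 j by apply: sumr_ge0.
have u1i : u 0 i + \sum_(j | j != i) u 0 j = 1 by rewrite -u1 [RHS](bigD1 i).
have rest0 : \sum_(j | j != i) u 0 j = 0.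
  by move: rest_ge0 u1i ui1; set s := \sum_(j | _) _; lra.
exists i; apply/rowP => j; rewrite mxE eqxx /=.
have [->|ji] := eqVneq j i; first by move: u1i; rewrite rest0 addr0.
exact: (psumr_eq0P (fun k _ => u0 k) rest0).
Qed.

Lemma unit_vector_diff_inj (d : nat) (i j k l : 'I_d) : i != j ->
  delta_mx 0 i - delta_mx 0 j = delta_mx 0 k - delta_mx 0 l :> 'rV[int]_d ->
  i = k /\ j = l.
Proof.
move=> ij /rowP E.
(* Coordinate [i] of the difference is [1], which forces [k = i]; coordinate
   [j] is [-1], which forces [l = j]. *)
have := E i; have := E j; rewrite !mxE !eqxx (negbTE ij) eq_sym (negbTE ij) /=.
by do 4!case: eqP => // ?.
Qed.

Theorem proposition2p3 (V : finType) (e : rel V)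
    (e_sym : symmetric e) (e_irr : irreflexive e) :
  exists (d : nat) (P : set 'rV[rat]_d) (M : set 'rV[int]_d),
    [/\ lattice_polytope P, set_of_moves M &
        graph_isomorphic e (fiber_graph P M)].
Proof.
pose S : set 'rV[rat]_#|V| := range (fun i : 'I_#|V| => delta_mx 0 i).
pose node (x : V) : 'rV[int]_#|V| := delta_mx 0 (enum_rank x).
pose move_of (p : V * V) := node p.1 - node p.2.
pose M := move_of @` [set p | e p.1 p.2].
have e_neq x y : e x y -> enum_rank x != enum_rank y.
  by apply: contraTneq => /enum_rank_inj ->; rewrite e_irr.
exists #|V|, (convex_hull S), M; split.
- split; first by exists S => //; apply: finite_image; apply: finite_finset.
  move=> v /vertex_convex_hull [i _ <-]; exists (delta_mx 0 i) => //.
  by rewrite /int_to_rat map_delta_mx.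
- split.
  + by apply: finite_image; apply: finite_finset.
  + move=> [[x y] /= exy /rowP /(_ (enum_rank x))].
    by rewrite !mxE !eqxx (negbTE (e_neq _ _ exy)).
  + apply/seteqP; split=> [_ [[x y] /= exy <-]|_ [_ [[x y] /= exy <-] <-]].
      exists (node y - node x); last by rewrite opprB.
      by exists (y, x); rewrite //= e_sym.
    by exists (y, x); rewrite /= 1?e_sym // /move_of opprB.
  + move=> l _ l2 [[x y] /= exy <-] [[z w] /= ezw /rowP /(_ (enum_rank x))].
    rewrite !(mulmxnE, mxE) !eqxx (negbTE (e_neq _ _ exy)) /=.
    (* The left coordinate is at most [1], the right one is [l]. *)
    rewrite subr0 => coord; have : 2%:R <= l%:R :> int by rewrite ler_nat.
    by rewrite -coord; do 2!case: eqP.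
have nodeP x : lattice_points (convex_hull S) (node x).
  rewrite /lattice_points /= /int_to_rat map_delta_mx.
  by apply: sub_gen_smallest; exists (enum_rank x).
pose f x : lattice_points (convex_hull S) := SigSub (mem_set (nodeP x)).
exists f.
  rewrite -setTT_bijective; split=> //.
    move=> x y _ _ /(congr1 val) /= /rowP /(_ (enum_rank x)).
    rewrite !mxE !eqxx /=; case: eqP => // /enum_rank_inj -> //.
  move=> u _; have [u0 u1] := hull_unit_vectors (set_valP u).
  have [i ui] : exists i, val u = delta_mx 0 i.
    apply: int_simplex_point => [i|].
      by have := u0 i; rewrite mxE ler0z.
    apply: (@intr_inj rat); rewrite rmorph_sum -[RHS]u1.
    by apply: eq_bigr => i _; rewrite mxE.
  by exists (enum_val i) => //; apply: val_inj; rewrite /= /node enum_valK ui.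
move=> x y; apply/idP/idP => [exy|/set_mem [[z w] /= ezw]].
  by apply/mem_set; exists (x, y).
case/(unit_vector_diff_inj (e_neq _ _ ezw)).
by move=> /enum_rank_inj <- /enum_rank_inj <-.
Qed.
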